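(* Let $\alpha\in[0,\tfrac12]$ and $\gamma\in\mathbb{R}$ with $|\gamma|\le 1$, and let $h>0$ be the grid size. At every staggered grid point $p$ let $\boldsymbol{D}_p=\begin{pmatrix} a_p & b_p\\ b_p & c_p\end{pmatrix}$ be the (real symmetric, positive semidefinite) diffusion tensor, with eigenvalues $\lambda_1(p)\ge\lambda_2(p)\ge 0$, and let $$\delta_p=\alpha\,(a_p+c_p)+\beta_p\,b_p,\qquad \beta_p=\gamma\,(1-2\alpha)\,\mathrm{sgn}(b_p).$$ Let $\boldsymbol{A}$ be the symmetric matrix that applies the corresponding space-variant $\delta$-stencil to an image with reflecting boundary conditions. Then the spectral norm $\rho(\boldsymbol{A})$ satisfies $$\rho(\boldsymbol{A})\;\le\;\max_{p}\;\frac{4\,(1-\alpha)\,(\lambda_1(p)+\lambda_2(p))+2\,\bigl(1-\gamma\,(1-2\alpha)\bigr)\,(\lambda_1(p)-\lambda_2(p))}{h^2},$$ where the maximum is over all staggered grid points $p$. (In particular, if the eigenvalues $\lambda_1\ge\lambda_2\ge0$ are the same at all staggered grid points, the bound holds with these $\lambda_1,\lambda_2$ and without the maximum.)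
   Context: Setting. A discrete image is $\boldsymbol{u}=(u_{i,j})$ with $1\le i\le n_1$, $1\le j\le n_2$, regarded as a vector in $\mathbb{R}^N$, $N=n_1n_2$; the grid size is $h>0$ in both directions. Staggered grid points are the points $(i+\tfrac12,j+\tfrac12)$ with $0\le i\le n_1$, $0\le j\le n_2$. At each of them a real symmetric positive semidefinite matrix (diffusion tensor) $\boldsymbol{D}=\begin{pmatrix} a & b \\ b & c \end{pmatrix}$ is given (it may vary from point to point), together with a real number $\delta$. Subscripts denote evaluation at a point. Values at the points $(i\pm\tfrac12,j)$ and $(i,j\pm\tfrac12)$ are defined by averaging: $$(a-\delta)_{i\pm\frac12,j}=\tfrac12\bigl((a-\delta)_{i\pm\frac12,j+\frac12}+(a-\delta)_{i\pm\frac12,j-\frac12}\bigr),$$ $$(c-\delta)_{i,j\pm\frac12}=\tfrac12\bigl((c-\delta)_{i+\frac12,j\pm\frac12}+(c-\delta)_{i-\frac12,j\pm\frac12}\bigr).$$ The $\delta$-stencil (a discretisation of $\mathrm{div}(\boldsymbol{D}\,\nabla u)$) defines the linear map $\boldsymbol{A}$ by $$\begin{aligned}(\boldsymbol{A}\boldsymbol{u})_{i,j}=\frac1{h^2}\Bigl[&(a-\delta)_{i+\frac12,j}(u_{i+1,j}-u_{i,j})+(a-\delta)_{i-\frac12,j}(u_{i-1,j}-u_{i,j})\\ &+(c-\delta)_{i,j+\frac12}(u_{i,j+1}-u_{i,j})+(c-\delta)_{i,j-\frac12}(u_{i,j-1}-u_{i,j})\\ &+\tfrac12(\delta+b)_{i+\frac12,j+\frac12}(u_{i+1,j+1}-u_{i,j})+\tfrac12(\delta+b)_{i-\frac12,j-\frac12}(u_{i-1,j-1}-u_{i,j})\\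 &+\tfrac12(\delta-b)_{i-\frac12,j+\frac12}(u_{i-1,j+1}-u_{i,j})+\tfrac12(\delta-b)_{i+\frac12,j-\frac12}(u_{i+1,j-1}-u_{i,j})\Bigr].\end{aligned}$$ Reflecting boundary conditions: values outside the image are obtained by mirroring, i.e. $u_{0,j}=u_{1,j}$, $u_{n_1+1,j}=u_{n_1,j}$, $u_{i,0}=u_{i,1}$, $u_{i,n_2+1}=u_{i,n_2}$ (applied in both directions at the corners), and, consistently with mirroring, $b=0$ at the boundary staggered points (those with $i\in\{0,n_1\}$ or $j\in\{0,n_2\}$). With these conventions $\boldsymbol{A}$ is a symmetric $N\times N$ matrix. $\rho(\boldsymbol{A})$ is the spectral norm of $\boldsymbol{A}$ (for symmetric $\boldsymbol{A}$, the largest absolute value of an eigenvalue). $\mathrm{sgn}$ is the sign function, with $\mathrm{sgn}(0)=0$ (the value at $0$ is irrelevant since only $\beta b$ enters). *)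

(* Defs.v *)
From HB Require Import structures.
From mathcomp Require Import all_boot all_order all_algebra.
From mathcomp Require Import boolp classical_sets reals.
From mathcomp Require Import ring.

Set Implicit Arguments.
Unset Strict Implicit.
Unset Printing Implicit Defensive.

Import Order.TTheory GRing.Theory Num.Theory.

Local Open Scope ring_scope.

(* Pixels are numbered from 0: an index i : 'I_n stands for the coordinate
   i + 1.  A staggered index k : 'I_n.+1 stands for the coordinate k + 1/2,
   so the pixel i lies between the staggered indices i and i + 1. *)
Definition staggered (n1 n2 : nat) : Type := ('I_n1.+1 * 'I_n2.+1)%type.

Definition half_below n (i : 'I_n) : 'I_n.+1 := widen_ord (leqnSn n) i.
Definition half_above n (i : 'I_n) : 'I_n.+1 := lift ord0 i.

(* [insubd i k] is k if k < n, and i otherwise.  Hence the successor of the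
   last pixel and the predecessor of the first one are the pixel itself:
   these are the mirrored values of the reflecting boundary conditions. *)
Definition mirror_succ n (i : 'I_n) : 'I_n := insubd i i.+1.
Definition mirror_pred n (i : 'I_n) : 'I_n := insubd i i.-1.

Definition on_boundary n1 n2 (p : staggered n1 n2) : Prop :=
  [\/ p.1 = ord0, p.1 = ord_max, p.2 = ord0 | p.2 = ord_max].

Section Stencil.
Variables (R : realType) (n1 n2 : nat).
Implicit Types (D : staggered n1 n2 -> 'M[R]_2) (g : staggered n1 n2 -> R).

Definition tensor_a D (p : staggered n1 n2) : R := D p 0 0.
Definition tensor_b D (p : staggered n1 n2) : R := D p 0 1.
Definition tensor_c D (p : staggered n1 n2) : R := D p 1 1.

Definition avg2 g (k : 'I_n1.+1) (j : 'I_n2) : R :=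
  2^-1 * (g (k, half_above j) + g (k, half_below j)).
Definition avg1 g (i : 'I_n1) (l : 'I_n2.+1) : R :=
  2^-1 * (g (half_above i, l) + g (half_below i, l)).

Definition delta_stencil (h : R) D (delta : staggered n1 n2 -> R)
    (u : 'M[R]_(n1, n2)) : 'M[R]_(n1, n2) :=
  let ad := avg2 (fun p => tensor_a D p - delta p) in
  let cd := avg1 (fun p => tensor_c D p - delta p) in
  let dpb p := delta p + tensor_b D p in
  let dmb p := delta p - tensor_b D p in
  \matrix_(i < n1, j < n2)
    let ip := half_above i in let im := half_below i in
    let jp := half_above j in let jm := half_below j in
    let i1 := mirror_succ i in let i0 := mirror_pred i in
    let j1 := mirror_succ j in let j0 := mirror_pred j in
    (h ^+ 2)^-1 *
      (  ad ip j * (u i1 j - u i j) + ad im j * (u i0 j - u i j)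
       + cd i jp * (u i j1 - u i j) + cd i jm * (u i j0 - u i j)
       + 2^-1 * dpb (ip, jp) * (u i1 j1 - u i j)
       + 2^-1 * dpb (im, jm) * (u i0 j0 - u i j)
       + 2^-1 * dmb (im, jp) * (u i0 j1 - u i j)
       + 2^-1 * dmb (ip, jm) * (u i1 j0 - u i j)).

Lemma delta_stencil_is_linear h D delta : linear (delta_stencil h D delta).
Proof.
by move=> x u v; apply/matrixP => i j; rewrite !mxE /= !mxE; ring.
Qed.

HB.instance Definition _ h D delta :=
  GRing.isLinear.Build R 'M[R]_(n1, n2) 'M[R]_(n1, n2) _
    (delta_stencil h D delta) (delta_stencil_is_linear h D delta).

(* An image u is the vector [mxvec u] of R^(n1 n2); following the convention
   of [lin_mx], matrices act on row vectors:
   mxvec u *m stencil_mx h D delta = mxvec (delta_stencil h D delta u). *)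
Definition stencil_mx (h : R) D (delta : staggered n1 n2 -> R) :
    'M[R]_(n1 * n2) :=
  lin_mx (delta_stencil h D delta).

Definition stencil_beta (alpha gamma : R) D (p : staggered n1 n2) : R :=
  gamma * (1 - 2 * alpha) * Num.sg (tensor_b D p).

Definition stencil_delta (alpha gamma : R) D (p : staggered n1 n2) : R :=
  alpha * (tensor_a D p + tensor_c D p)
  + stencil_beta alpha gamma D p * tensor_b D p.

End Stencil.

Definition psd_mx (R : realType) n (M : 'M[R]_n) : Prop :=
  M \is symmetricmx /\ forall v : 'rV[R]_n, 0 <= (v *m M *m v^T) 0 0.

(* The eigenvalues are counted with multiplicity. *)
Definition ordered_eigenvalues (R : realType) (M : 'M[R]_2) (l1 l2 : R) :
    Prop :=
  char_poly M = ('X - l1%:P) * ('X - l2%:P) /\ l2 <= l1.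

Definition l2norm (R : realType) n (v : 'rV[R]_n) : R :=
  Num.sqrt (\sum_(i < n) v 0 i ^+ 2).

Definition spectral_norm (R : realType) n (M : 'M[R]_n) : R :=
  sup [set l2norm (v *m M) | v in [set v : 'rV[R]_n | l2norm v <= 1]]%classic.

Definition spectral_bound (R : realType) (alpha gamma h l1 l2 : R) : R :=
  (4 * (1 - alpha) * (l1 + l2)
   + 2 * (1 - gamma * (1 - 2 * alpha)) * (l1 - l2)) / h ^+ 2.

(* Main.v *)
Require Import Defs.
From HB Require Import structures.
From mathcomp Require Import all_boot all_order all_algebra.
From mathcomp Require Import boolp classical_sets reals.
From mathcomp Require Import ring lra.

Set Implicit Arguments.
Unset Strict Implicit.
Unset Printing Implicit Defensive.

Import Order.TTheory GRing.Theory Num.Theory.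

Local Open Scope ring_scope.

(** Cut every pixel into four quarters, one around each of the four staggered
    points at its corners.  Let X and Y be the maps that reflect a quarter
    across the horizontal resp. vertical position of its staggered point.
    At the border of the image the mirrored neighbour of a pixel is the pixel
    itself, and X or Y fixes the quarter there; so X and Y are commuting
    involutions of the set of all quarters, they keep the staggered point, and
    the reflecting boundary conditions need no further case distinction.

    The three neighbours that a quarter sees around its staggered point are its
    images by X, Y and XY, and h^2 (A u) at a pixel is the sum over its four
    quarters q of
      1/2 [(a - delta) (u(Xq) - u(q)) + (c - delta) (u(Yq) - u(q))
           + (delta + e b) (u(XYq) - u(q))],
    where e = 1 on one diagonal pair of quarters and e = -1 on the other
    (lemma [delta_stencil_quarters]).  As b = 0 where X or Y has fixed points,
    e b changes sign under X and under Y.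

    On the four values of an orbit {q, Xq, Yq, XYq} this operator splits along
    the characters of the group generated by X and Y: it kills the
    constants, it acts as -D on the pair (horizontal difference, vertical
    difference), up to the sign e of b, and it multiplies the checkerboard
    pattern by -(a + c - 2 delta).  So it multiplies the sum of
    squares by at most m^2 if m bounds lambda1 and |a + c - 2 delta|
    ([orbit_flux_le]).  Each pixel has four quarters: lifting
    u to the quarters multiplies the norm by 2, and adding up the quarters of
    a pixel costs another factor 2 by the Cauchy-Schwarz inequality.  Hence
    |A u| <= 4 m / h^2 |u| ([stencil_sqnorm_le]).

    It remains to compare numbers ([bound_numerator_ge]): both 4 lambda1 and
    4 (a + c - 2 delta) are at most the numerator of the claimed bound, thanks
    to lambda2 >= 0, 2 |b| <= lambda1 - lambda2 and |gamma (1 - 2 alpha)| <= 1,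
    while 2 |b| <= a + c gives a + c - 2 delta >= 0. *)

(** * The four values around one staggered point *)

(** The flux into a quarter with value f whose images by X, Y and XY have the
    values fx, fy and fxy. *)
Definition flux_form (R : realType) (a c delta b f fx fy fxy : R) : R :=
  2^-1 * ((a - delta) * (fx - f) + (c - delta) * (fy - f)
          + (delta + b) * (fxy - f)).

Section TwoByTwo.
Variable R : realType.

Lemma sum_ord2 (F : 'I_2 -> R) : \sum_(i < 2) F i = F 0 + F 1.
Proof.
rewrite !big_ord_recl big_ord0 addr0; congr (_ + F _); exact/val_inj.
Qed.

Lemma det_mx2 (M : 'M[R]_2) : \det M = M 0 0 * M 1 1 - M 0 1 * M 1 0.
Proof.
have lift01 : lift 0 0 = 1 :> 'I_2 by exact/val_inj.
have lift10 : lift 1 0 = 0 :> 'I_2 by exact/val_inj.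
rewrite (expand_det_row _ 0) sum_ord2 /cofactor !det_mx11 !mxE lift01 lift10.
by rewrite /= expr0 expr1 mul1r mulN1r mulrN.
Qed.

Lemma eigenvalues_trace_det (M : 'M[R]_2) (l1 l2 : R) :
  ordered_eigenvalues M l1 l2 ->
  M 0 0 + M 1 1 = l1 + l2 /\ M 0 0 * M 1 1 - M 0 1 * M 1 0 = l1 * l2.
Proof.
case=> charM _; split.
  have := char_poly_trace M (isT : (0 < 2)%N).
  rewrite charM /mxtrace sum_ord2 /= mulrBl !mulrBr opprB -expr2.
  rewrite !coefE /= => trM; lra.
have := char_poly_det M; rewrite charM det_mx2 /= -horner_coef0 !hornerE.
by move=> detM; lra.
Qed.

Lemma psd_mx_sym22 (M : 'M[R]_2) : psd_mx M -> M 1 0 = M 0 1.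
Proof.
by case=> /is_hermitianmxP symM _; rewrite {1}symM !mxE /= expr0 mul1r.
Qed.

Lemma psd_form22 (M : 'M[R]_2) (x y : R) : psd_mx M ->
  0 <= M 0 0 * x ^+ 2 + 2 * M 0 1 * x * y + M 1 1 * y ^+ 2.
Proof.
move=> psdM; have := psdM.2 (\row_j (if j == 0 then x else y)).
by rewrite !mxE sum_ord2 !mxE !sum_ord2 !mxE /= (psd_mx_sym22 psdM); lra.
Qed.

(** The row (b, lambda2 - a) is an eigenvector of M for lambda2 unless it
    vanishes, and it does not vanish if lambda2 < 0 <= a. *)
Lemma smaller_eigenvalue_ge0 (M : 'M[R]_2) (l1 l2 : R) :
  psd_mx M -> ordered_eigenvalues M l1 l2 -> 0 <= l2.
Proof.
move=> psdM eigM; have [tr_eq det_eq] := eigenvalues_trace_det eigM.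
have a_ge0 := psd_form22 1 0 psdM.
have qf_ge0 := psd_form22 (M 0 1) (l2 - M 0 0) psdM.
move: tr_eq det_eq a_ge0 qf_ge0; rewrite psd_mx_sym22 //.
set a := M 0 0; set b := M 0 1; set c := M 1 1 => tr_eq det_eq a_ge0 qf_ge0.
rewrite leNgt; apply/negP => l2_lt0.
have c_eq : c = l1 + l2 - a by lra.
have : 0 <= l2 * (b ^+ 2 + (l2 - a) ^+ 2).
  apply: le_trans qf_ge0 _; rewrite le_eqVlt; apply/orP; left; apply/eqP.
  have b2 : b ^+ 2 = a * (l1 + l2 - a) - l1 * l2 by rewrite -c_eq; lra.
  transitivity ((2 * l2 - a) * b ^+ 2 + c * (l2 - a) ^+ 2); first by ring.
  by rewrite mulrDr b2 c_eq; ring.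
rewrite nmulr_rge0 // leNgt => /negP; apply.
by rewrite ltr_wpDl ?sqr_ge0 // exprn_even_gt0 //= lt_eqF //; lra.
Qed.

(** With v = (x, y), Cayley-Hamilton gives
    |D v|^2 = (l1 + l2) <D v, v> - l1 l2 |v|^2, and the claim reduces to
    <D v, v> <= l1 |v|^2, that is, to 0 <= q in the proof. *)
Lemma sym22_norm_le (a b c l1 l2 x y : R) :
  a + c = l1 + l2 -> a * c - b ^+ 2 = l1 * l2 -> 0 <= l2 -> l2 <= l1 ->
  (a * x + b * y) ^+ 2 + (b * x + c * y) ^+ 2 <= l1 ^+ 2 * (x ^+ 2 + y ^+ 2).
Proof.
move=> tr_eq det_eq l2_ge0 l2_le1.
have c_eq : c = l1 + l2 - a by lra.
have b2 : b ^+ 2 = a * (l1 + l2 - a) - l1 * l2 by rewrite -c_eq; lra.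
pose q := (l1 - a) * x ^+ 2 - 2 * b * x * y + (l1 - c) * y ^+ 2.
have q_ge0 : 0 <= q.
  (* Multiplying q by the trace l1 - l2 of the singular matrix l1 - D turns it
     into a sum of two squares; if the trace is 0, then D is l1 times 1. *)
  have [eq12|ne12] := eqVneq l1 l2.
    have b0 : b = 0.
      apply/eqP; rewrite -sqrf_eq0 eq_le sqr_ge0 b2 eq12 andbT.
      by have := sqr_ge0 (a - l2); lra.
    have a_eq : a = l1.
      apply/eqP; rewrite -subr_eq0 -sqrf_eq0; apply/eqP.
      by move: b2; rewrite b0 expr0n /= eq12; lra.
    by rewrite /q b0 c_eq a_eq eq12; lra.
  have d_gt0 : 0 < l1 - l2 by rewrite subr_gt0 lt_neqAle eq_sym ne12.
  rewrite -(pmulr_rge0 _ d_gt0).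
  suff -> : (l1 - l2) * q
      = ((l1 - a) * x - b * y) ^+ 2 + (b * x - (l1 - c) * y) ^+ 2.
    by rewrite addr_ge0 ?sqr_ge0.
  transitivity (((l1 - a) ^+ 2 + b ^+ 2) * x ^+ 2
                - 2 * b * (l1 - l2) * x * y
                + ((l1 - c) ^+ 2 + b ^+ 2) * y ^+ 2).
    by rewrite /q b2 c_eq; ring.
  by rewrite c_eq; ring.
rewrite -subr_ge0.
suff -> : l1 ^+ 2 * (x ^+ 2 + y ^+ 2)
    - ((a * x + b * y) ^+ 2 + (b * x + c * y) ^+ 2) = (l1 + l2) * q.
  by rewrite mulr_ge0 //; lra.
transitivity ((l1 ^+ 2 - a ^+ 2 - b ^+ 2) * x ^+ 2
  - 2 * b * (l1 + l2) * x * y + (l1 ^+ 2 - c ^+ 2 - b ^+ 2) * y ^+ 2).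
  by rewrite c_eq; ring.
by rewrite /q b2 c_eq; ring.
Qed.

(** x and y are the differences in the two directions, w is the checkerboard
    component and s the sum of the four values: these are orthogonal
    coordinates, in which the flux is -D on (x, y), -(a + c - 2 delta) on w and
    0 on s.  The sign of b alternates because the two diagonals through a
    staggered point carry the weights delta + b and delta - b. *)
Lemma orbit_flux_le (a b c delta l1 l2 m f0 f1 f2 f3 : R) :
  a + c = l1 + l2 -> a * c - b ^+ 2 = l1 * l2 -> 0 <= l2 -> l2 <= l1 ->
  l1 <= m -> `|a + c - 2 * delta| <= m ->
  flux_form a c delta b f0 f1 f2 f3 ^+ 2
  + flux_form a c delta (- b) f1 f0 f3 f2 ^+ 2
  + (flux_form a c delta (- b) f2 f3 f0 f1 ^+ 2
     + flux_form a c delta b f3 f2 f1 f0 ^+ 2)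
  <= m ^+ 2 * (f0 ^+ 2 + f1 ^+ 2 + (f2 ^+ 2 + f3 ^+ 2)).
Proof.
move=> tr_eq det_eq l2_ge0 l2_le1 l1_le_m w_le_m.
pose x : R := f0 - f1 + f2 - f3; pose y : R := f0 + f1 - f2 - f3.
pose w : R := f0 - f1 - f2 + f3; pose s : R := f0 + f1 + f2 + f3.
have -> : flux_form a c delta b f0 f1 f2 f3 ^+ 2
  + flux_form a c delta (- b) f1 f0 f3 f2 ^+ 2
  + (flux_form a c delta (- b) f2 f3 f0 f1 ^+ 2
     + flux_form a c delta b f3 f2 f1 f0 ^+ 2)
  = 4^-1 * ((a * x + b * y) ^+ 2 + (b * x + c * y) ^+ 2
            + (a + c - 2 * delta) ^+ 2 * w ^+ 2).
  by rewrite /flux_form /x /y /w; field.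
have -> : f0 ^+ 2 + f1 ^+ 2 + (f2 ^+ 2 + f3 ^+ 2)
  = 4^-1 * (x ^+ 2 + y ^+ 2 + w ^+ 2 + s ^+ 2).
  by rewrite /x /y /w /s; field.
have Dxy := sym22_norm_le x y tr_eq det_eq l2_ge0 l2_le1.
have m2 : l1 ^+ 2 <= m ^+ 2 by rewrite lerXn2r ?nnegrE //; lra.
have w2 : (a + c - 2 * delta) ^+ 2 <= m ^+ 2.
  by rewrite -real_normK ?num_real // lerXn2r ?nnegrE //; lra.
rewrite [leRHS]mulrCA ler_pM2l ?invr_gt0 //.
rewrite (mulrDr _ _ (s ^+ 2)) (mulrDr _ _ (w ^+ 2)).
apply: ler_wpDr; first by rewrite -exprMn sqr_ge0.
apply: lerD.
  by apply: le_trans Dxy _; rewrite ler_wpM2r // addr_ge0 ?sqr_ge0.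
by rewrite ler_wpM2r ?sqr_ge0.
Qed.

End TwoByTwo.

(** * Quarters of pixels and their reflections *)

(** A quarter is a pair of half pixels, one for each axis.  The boolean tells
    whether the half is the upper one, next to the staggered index above the
    pixel. *)
Definition half_pixel n : finType := ('I_n * bool)%type.

Section HalfPixel.
Variable n : nat.
Implicit Type q : half_pixel n.

Definition line_of q : 'I_n.+1 :=
  if q.2 then half_above q.1 else half_below q.1.

Definition at_border q : bool := if q.2 then q.1.+1 == n else q.1 == 0 :> nat.

(** A half pixel at the border is its own mirror image: flipping its boolean
    would change its staggered index. *)
Definition reflect_half q : half_pixel n :=
  if at_border q then q
  else (if q.2 then mirror_succ q.1 else mirror_pred q.1, ~~ q.2).

Lemma val_mirror_succ (i : 'I_n) :
  mirror_succ i = (if i.+1 == n then i : nat else i.+1) :> nat.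
Proof.
rewrite val_insubd; case: (ltngtP i.+1 n) => //.
by rewrite ltnNge ltn_ord.
Qed.

Lemma val_mirror_pred (i : 'I_n) : mirror_pred i = i.-1 :> nat.
Proof. by rewrite val_insubd (leq_ltn_trans (leq_pred i)). Qed.

(** Thanks to the mirrored values the pixel of the reflection has one formula,
    with no exception at the border. *)
Lemma reflect_half1 q :
  (reflect_half q).1 = if q.2 then mirror_succ q.1 else mirror_pred q.1.
Proof.
rewrite /reflect_half /at_border; case: q => i [] /=; case: ifP => //= border.
  by apply/val_inj; rewrite /= val_mirror_succ border.
by apply/val_inj; rewrite /= val_mirror_pred (eqP border).
Qed.

Lemma reflect_halfK : involutive reflect_half.
Proof.
move=> [i s]; case border: (at_border (i, s)).
  by rewrite /reflect_half border border.
rewrite [reflect_half (i, s)]/reflect_half border /reflect_half /at_border.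
case: s border; rewrite /at_border /= => border.
  rewrite val_mirror_succ border /=.
  congr pair; apply/val_inj.
  by rewrite /= val_mirror_pred val_mirror_succ border.
have i_gt0 : (0 < i)%N by rewrite lt0n border.
rewrite val_mirror_pred prednK // (ltn_eqF (ltn_ord i)).
congr pair; apply/val_inj.
by rewrite /= val_mirror_succ val_mirror_pred prednK // (ltn_eqF (ltn_ord i)).
Qed.

Lemma line_of_reflect q : line_of (reflect_half q) = line_of q.
Proof.
rewrite /reflect_half; case: ifP => // border; apply/val_inj.
case: q border => i [] /=; rewrite /at_border /line_of /= => border.
  by rewrite val_mirror_succ border.
by rewrite /bump /= val_mirror_pred add1n prednK // lt0n border.
Qed.

Lemma line_of_border q :
  at_border q -> line_of q = ord0 \/ line_of q = ord_max.
Proof.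
case: q => i []; rewrite /at_border /line_of /= => /eqP border.
  by right; apply/val_inj; rewrite /= /bump /= add1n.
by left; apply/val_inj.
Qed.

End HalfPixel.

(** * The stencil as a sum of fluxes into quarters *)

Section QuarterFlux.
Variables (R : realType) (n1 n2 : nat).
Variables (D : staggered n1 n2 -> 'M[R]_2) (delta : staggered n1 n2 -> R).
Hypothesis D_boundary : forall p, on_boundary p -> tensor_b D p = 0.

Definition point_of (q1 : half_pixel n1) (q2 : half_pixel n2) :
  staggered n1 n2 := (line_of q1, line_of q2).

(** The weight delta + b belongs to the diagonal along which both coordinates
    grow, which meets the quarters whose booleans agree. *)
Definition signed_b q1 q2 : R :=
  (-1) ^+ (q1.2 (+) q2.2) * tensor_b D (point_of q1 q2).

(** Inside the image the reflection flips a boolean; where it is the identity,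
    b = 0, so that the sign rule still holds. *)
Lemma signed_b_reflect1 q1 q2 :
  signed_b (reflect_half q1) q2 = - signed_b q1 q2.
Proof.
rewrite /signed_b /point_of line_of_reflect.
rewrite /reflect_half; case: ifP => [border|_] /=.
  rewrite D_boundary ?mulr0 ?oppr0 //.
  by case: (line_of_border border) => ?; [constructor 1|constructor 2].
by rewrite addNb signrN mulNr.
Qed.

Lemma signed_b_reflect2 q1 q2 :
  signed_b q1 (reflect_half q2) = - signed_b q1 q2.
Proof.
rewrite /signed_b /point_of line_of_reflect.
rewrite /reflect_half; case: ifP => [border|_] /=.
  rewrite D_boundary ?mulr0 ?oppr0 //.
  by case: (line_of_border border) => ?; [constructor 3|constructor 4].
by rewrite addbN signrN mulNr.
Qed.

Definition quarter_flux (u : 'M[R]_(n1, n2)) q1 q2 : R :=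
  let p := point_of q1 q2 in
  let i := q1.1 in let j := q2.1 in
  let i' := (reflect_half q1).1 in let j' := (reflect_half q2).1 in
  flux_form (tensor_a D p) (tensor_c D p) (delta p) (signed_b q1 q2)
    (u i j) (u i' j) (u i j') (u i' j').

Lemma delta_stencil_quarters h u i j :
  delta_stencil h D delta u i j =
  (h ^+ 2)^-1 *
    (quarter_flux u (i, true) (j, true) + quarter_flux u (i, true) (j, false)
   + (quarter_flux u (i, false) (j, true)
      + quarter_flux u (i, false) (j, false))).
Proof.
rewrite mxE /quarter_flux /flux_form !reflect_half1 /= /signed_b /= expr0 expr1.
by rewrite /avg2 /avg1 /point_of /line_of /=; ring.
Qed.

Lemma sum_half_pixels n (F : half_pixel n -> R) :
  \sum_q F q = \sum_i (F (i, true) + F (i, false)).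
Proof.
rewrite (eq_bigr (fun q => F (q.1, q.2))) => [|[]//].
rewrite -(pair_bigA _ (fun i s => F (i, s))) /=.
by apply: eq_bigr => i _; rewrite big_bool.
Qed.

Lemma sum_quarters (G : half_pixel n1 -> half_pixel n2 -> R) :
  \sum_q1 \sum_q2 G q1 q2 =
  \sum_i \sum_j (G (i, true) (j, true) + G (i, true) (j, false)
                 + (G (i, false) (j, true) + G (i, false) (j, false))).
Proof.
rewrite sum_half_pixels; apply: eq_bigr => i _.
by rewrite !sum_half_pixels -big_split.
Qed.

(** Reflections permute the quarters, so every quarter may be replaced by its
    orbit; this also counts the smaller orbits at the border correctly. *)
Lemma sum_orbits (G : half_pixel n1 -> half_pixel n2 -> R) :
  4 * \sum_q1 \sum_q2 G q1 q2 =
  \sum_q1 \sum_q2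
    (G q1 q2 + G (reflect_half q1) q2
     + (G q1 (reflect_half q2) + G (reflect_half q1) (reflect_half q2))).
Proof.
have refl1 F : \sum_(q : half_pixel n1) F (reflect_half q) = \sum_q F q :> R.
  by rewrite [RHS](reindex_inj (inv_inj (@reflect_halfK n1))).
have refl2 F : \sum_(q : half_pixel n2) F (reflect_half q) = \sum_q F q :> R.
  by rewrite [RHS](reindex_inj (inv_inj (@reflect_halfK n2))).
under [RHS]eq_bigr => q1 _ do
  rewrite !big_split /= refl2 (refl2 (G (reflect_half _))).
rewrite !big_split /= (refl1 (fun q1 => \sum_q2 G q1 q2)).
by ring.
Qed.

Variables (lambda1 lambda2 : staggered n1 n2 -> R) (m : R).
Hypothesis D_psd : forall p, psd_mx (D p).
Hypothesis D_eigen :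
  forall p, ordered_eigenvalues (D p) (lambda1 p) (lambda2 p).
Hypothesis lambda1_le : forall p, lambda1 p <= m.
Hypothesis checker_le :
  forall p, `|tensor_a D p + tensor_c D p - 2 * delta p| <= m.

Lemma sum_quarter_flux_le u :
  \sum_q1 \sum_q2 quarter_flux u q1 q2 ^+ 2
  <= m ^+ 2 * (4 * \sum_i \sum_j u i j ^+ 2).
Proof.
have -> : 4 * \sum_i \sum_j u i j ^+ 2
  = \sum_(q1 : half_pixel n1) \sum_(q2 : half_pixel n2) u q1.1 q2.1 ^+ 2.
  rewrite (sum_quarters (fun q1 q2 => u q1.1 q2.1 ^+ 2)) /= mulr_sumr.
  apply: eq_bigr => i _; rewrite mulr_sumr; apply: eq_bigr => j _; ring.
rewrite -(@ler_pM2l _ 4) // (mulrCA 4).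
rewrite (sum_orbits (fun q1 q2 => quarter_flux u q1 q2 ^+ 2)).
rewrite (sum_orbits (fun q1 q2 => u q1.1 q2.1 ^+ 2)) mulr_sumr.
apply: ler_sum => q1 _; rewrite mulr_sumr; apply: ler_sum => q2 _.
set p := point_of q1 q2.
have [tr_eq det_eq] := eigenvalues_trace_det (D_eigen p).
have sym_p := psd_mx_sym22 (D_psd p).
have l2_ge0 := smaller_eigenvalue_ge0 (D_psd p) (D_eigen p).
have det_eq' : tensor_a D p * tensor_c D p - signed_b q1 q2 ^+ 2
             = lambda1 p * lambda2 p.
  by rewrite /signed_b -/p exprMn sqrr_sign mul1r -det_eq sym_p expr2.
have := orbit_flux_le (u q1.1 q2.1) (u (reflect_half q1).1 q2.1)
  (u q1.1 (reflect_half q2).1) (u (reflect_half q1).1 (reflect_half q2).1)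
  tr_eq det_eq' l2_ge0 (D_eigen p).2 (lambda1_le p) (checker_le p).
rewrite /quarter_flux !signed_b_reflect1 !signed_b_reflect2.
by rewrite /point_of !reflect_halfK !line_of_reflect opprK.
Qed.

Lemma stencil_sqnorm_le h u : 0 < h ->
  \sum_i \sum_j delta_stencil h D delta u i j ^+ 2
  <= (4 * m / h ^+ 2) ^+ 2 * \sum_i \sum_j u i j ^+ 2.
Proof.
move=> h_gt0.
have CS (x y z t : R) : (x + y + (z + t)) ^+ 2
    <= 4 * (x ^+ 2 + y ^+ 2 + (z ^+ 2 + t ^+ 2)).
  have := sqr_ge0 (x - y); have := sqr_ge0 (x - z); have := sqr_ge0 (x - t).
  have := sqr_ge0 (y - z); have := sqr_ge0 (y - t); have := sqr_ge0 (z - t).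
  lra.
apply: (@le_trans _ _ ((h ^+ 2)^-1 ^+ 2 *
    (4 * \sum_q1 \sum_q2 quarter_flux u q1 q2 ^+ 2))).
  rewrite (sum_quarters (fun q1 q2 => quarter_flux u q1 q2 ^+ 2)).
  rewrite !mulr_sumr; apply: ler_sum => i _.
  rewrite !mulr_sumr; apply: ler_sum => j _.
  by rewrite delta_stencil_quarters exprMn ler_wpM2l ?sqr_ge0.
have -> : (4 * m / h ^+ 2) ^+ 2 * \sum_i \sum_j u i j ^+ 2 =
    (h ^+ 2)^-1 ^+ 2 * (4 * (m ^+ 2 * (4 * \sum_i \sum_j u i j ^+ 2))).
  by ring.
by rewrite ler_wpM2l ?sqr_ge0 // ler_pM2l // sum_quarter_flux_le.
Qed.

End QuarterFlux.

(** * Comparison with the claimed bound *)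

Lemma trace_minus_delta_ge0 (R : realType) (alpha gamma a b c : R) :
  0 <= alpha <= 2^-1 -> `|gamma| <= 1 -> 2 * `|b| <= a + c ->
  0 <= a + c - 2 * (alpha * (a + c)
                    + gamma * (1 - 2 * alpha) * Num.sg b * b).
Proof.
move=> /andP[alpha_ge0 alpha_le] gamma_bound b_le.
rewrite -[_ * Num.sg b * b]mulrA -normrEsg.
have -> : a + c - 2 * (alpha * (a + c) + gamma * (1 - 2 * alpha) * `|b|)
  = (1 - 2 * alpha) * (a + c - 2 * (gamma * `|b|)) by ring.
apply: mulr_ge0; first lra.
have gb : gamma * `|b| <= `|b|.
  by rewrite -[leRHS]mul1r ler_wpM2r // (le_trans (ler_norm gamma)).
lra.
Qed.

(** For the second inequality put g = gamma (1 - 2 alpha) and d = l1 - l2: the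
    gap is 4 alpha (l1 + l2) + 2 (1 - g) (d - 2 |b|) + 4 (1 + g) |b|. *)
Lemma bound_numerator_ge (R : realType) (alpha gamma a b c l1 l2 : R) :
  0 <= alpha <= 2^-1 -> `|gamma| <= 1 ->
  a + c = l1 + l2 -> a * c - b ^+ 2 = l1 * l2 -> 0 <= l2 -> l2 <= l1 ->
  let N := 4 * (1 - alpha) * (l1 + l2)
           + 2 * (1 - gamma * (1 - 2 * alpha)) * (l1 - l2) in
  4 * l1 <= N /\
  4 * (a + c - 2 * (alpha * (a + c)
                    + gamma * (1 - 2 * alpha) * Num.sg b * b)) <= N.
Proof.
move=> /andP[alpha_ge0 alpha_le] gamma_bound tr_eq det_eq l2_ge0 l2_le1 N.
have k_ge0 : 0 <= 1 - 2 * alpha by lra.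
move: gamma_bound; rewrite ler_norml => /andP[gamma_ge gamma_le].
split; rewrite -subr_ge0.
  have -> : N - 4 * l1 = 4 * ((1 - 2 * alpha) * l2)
      + 2 * ((1 - gamma) * ((1 - 2 * alpha) * (l1 - l2))) by rewrite /N; ring.
  by rewrite addr_ge0 // mulr_ge0 // ?mulr_ge0 //; lra.
rewrite -[_ * Num.sg b * b]mulrA -normrEsg tr_eq.
pose g := gamma * (1 - 2 * alpha).
have g_le : `|g| <= 1.
  rewrite normrM (ger0_norm k_ge0) -[leRHS]mulr1 ler_pM //; last lra.
  by rewrite ler_norml gamma_ge.
move: g_le; rewrite ler_norml => /andP[g_ge g_le].
have b_le : 2 * `|b| <= l1 - l2.
  rewrite -ler_sqr ?nnegrE ?mulr_ge0 ?subr_ge0 //.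
  rewrite exprMn real_normK ?num_real //.
  have -> : (l1 - l2) ^+ 2 = (l1 + l2) ^+ 2 - 4 * (l1 * l2) by ring.
  rewrite -tr_eq -det_eq -subr_ge0.
  suff -> : (a + c) ^+ 2 - 4 * (a * c - b ^+ 2) - 2 ^+ 2 * b ^+ 2
    = (a - c) ^+ 2 by apply: sqr_ge0.
  by ring.
have -> : N - 4 * (l1 + l2 - 2 * (alpha * (l1 + l2)
                                  + gamma * (1 - 2 * alpha) * `|b|))
  = 4 * (alpha * (l1 + l2)) + 2 * ((1 - g) * (l1 - l2 - 2 * `|b|))
    + 2 * ((1 + g) * (2 * `|b|)).
  by rewrite /N /g; ring.
by rewrite !addr_ge0 // mulr_ge0 // mulr_ge0 ?mulr_ge0 //; lra.
Qed.

(** * From the quarter estimate to the spectral norm *)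

Section SpectralNorm.
Variable R : realType.

Lemma l2norm_mxvec (n1 n2 : nat) (u : 'M[R]_(n1, n2)) :
  l2norm (mxvec u) = Num.sqrt (\sum_i \sum_j u i j ^+ 2).
Proof.
congr Num.sqrt; rewrite pair_bigA /=.
rewrite (reindex (uncurry (@mxvec_index n1 n2))) /=; last first.
  exact: (subon_bij _ (curry_mxvec_bij _ _)).
by apply: eq_bigr => -[i j] _; rewrite /= mxvecE.
Qed.

Lemma spectral_norm_le n (M : 'M[R]_n) (k : R) : 0 <= k ->
  (forall v, l2norm (v *m M) <= k * l2norm v) -> spectral_norm M <= k.
Proof.
move=> k_ge0 M_le; apply: ge_sup.
  exists (l2norm (0 *m M)); exists 0 => //=.
  by rewrite /l2norm big1 ?sqrtr0 // => i _; rewrite mxE expr0n.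
move=> _ [v v_le1 <-]; apply: le_trans (M_le v) _.
by rewrite -[leRHS]mulr1 ler_wpM2l.
Qed.

End SpectralNorm.

(** The common source of both claims, with K the maximum over the staggered
    points or the constant bound. *)
Lemma stencil_spectral_norm_le (R : realType) (n1 n2 : nat)
    (alpha gamma h K : R) (D : staggered n1 n2 -> 'M[R]_2)
    (lambda1 lambda2 : staggered n1 n2 -> R) :
  0 <= alpha <= 2^-1 -> `|gamma| <= 1 -> 0 < h ->
  (forall p, psd_mx (D p)) ->
  (forall p, on_boundary p -> tensor_b D p = 0) ->
  (forall p, ordered_eigenvalues (D p) (lambda1 p) (lambda2 p)) ->
  (forall p, spectral_bound alpha gamma h (lambda1 p) (lambda2 p) <= K) ->
  spectral_norm (stencil_mx h D (stencil_delta alpha gamma D)) <= K.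
Proof.
move=> alpha_bounds gamma_bound h_gt0 D_psd D_boundary D_eigen K_ge.
have h2_gt0 : 0 < h ^+ 2 by rewrite exprn_gt0.
(* With this m the constant 4 m / h ^+ 2 of the norm estimate is K. *)
pose m := K * h ^+ 2 / 4.
have K_eq : 4 * m / h ^+ 2 = K by rewrite /m; field; rewrite lt0r_neq0.
have l2_ge0 p : 0 <= lambda2 p.
  exact: smaller_eigenvalue_ge0 (D_psd p) (D_eigen p).
have m_ge p : lambda1 p <= m
    /\ tensor_a D p + tensor_c D p - 2 * stencil_delta alpha gamma D p <= m.
  have [tr_eq det_eq] := eigenvalues_trace_det (D_eigen p).
  rewrite (psd_mx_sym22 (D_psd p)) -expr2 in det_eq.
  have [ge1 ge2] := bound_numerator_ge alpha_bounds gamma_bound tr_eq det_eq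
    (l2_ge0 p) (D_eigen p).2.
  have := K_ge p; rewrite /spectral_bound ler_pdivrMr // => N_le.
  by rewrite !ler_pdivlMr // ![_ * 4]mulrC; split; apply: le_trans N_le.
have w_ge0 p :
    0 <= tensor_a D p + tensor_c D p - 2 * stencil_delta alpha gamma D p.
  apply: trace_minus_delta_ge0 => //.
  have fp := psd_form22 1 1 (D_psd p).
  have fm := psd_form22 1 (-1) (D_psd p).
  rewrite /tensor_a /tensor_b /tensor_c.
  by case: (ler0P (D p 0 1)) => _; lra.
have m_ge0 : 0 <= m.
  have p0 : staggered n1 n2 := (ord0, ord0).
  by apply: le_trans (l2_ge0 p0) _; apply: le_trans (D_eigen p0).2 (m_ge p0).1.
have K_ge0 : 0 <= K.
  by rewrite -K_eq; apply: divr_ge0; [apply: mulr_ge0 | apply: ltW].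
apply: spectral_norm_le => // v; rewrite -(vec_mxK v) mul_vec_lin !l2norm_mxvec.
rewrite -{1}(ger0_norm K_ge0) -sqrtr_sqr -sqrtrM ?sqr_ge0 //.
rewrite ler_wsqrtr // -K_eq.
apply: (stencil_sqnorm_le D_boundary D_psd D_eigen) => // p.
  exact: (m_ge p).1.
by rewrite ger0_norm ?w_ge0 // (m_ge p).2.
Qed.

Theorem theorem1 (R : realType) (n1 n2 : nat) (alpha gamma h : R)
    (D : staggered n1 n2 -> 'M[R]_2) (lambda1 lambda2 : staggered n1 n2 -> R)
    (n1_gt0 : (0 < n1)%N) (n2_gt0 : (0 < n2)%N)
    (alpha_bounds : 0 <= alpha <= 2^-1) (gamma_bound : `|gamma| <= 1)
    (h_gt0 : 0 < h)
    (D_psd : forall p, psd_mx (D p))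
    (D_boundary : forall p, on_boundary p -> tensor_b D p = 0)
    (D_eigen : forall p, ordered_eigenvalues (D p) (lambda1 p) (lambda2 p)) :
  let A := stencil_mx h D (stencil_delta alpha gamma D) in
  let bound p := spectral_bound alpha gamma h (lambda1 p) (lambda2 p) in
  spectral_norm A
    <= \big[Num.max/bound (ord0, ord0)]_(p : staggered n1 n2) bound p
  /\ (forall l1 l2 : R,
        (forall p, lambda1 p = l1 /\ lambda2 p = l2) ->
        spectral_norm A <= spectral_bound alpha gamma h l1 l2).
Proof.
move=> A bound; split=> [|l1 l2 l12].
  by apply: stencil_spectral_norm_le => // p; apply: le_bigmax.
by apply: stencil_spectral_norm_le => // p; have [-> ->] := l12 p.
Qed.
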